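(* Let $f(z)=z+\sum_{k=2}^\infty b_kz^k\in\mathscr{S}^*_\wp$. Then $|H_3(1)|\le 0.150627$, where $H_3(1)=b_3(b_2b_4-b_3^2)-b_4(b_4-b_2b_3)+b_5(b_3-b_2^2)$.
   Context: $\mathbb{D}$ is the unit disk; $\mathcal{A}$ is the class of analytic $f$ on $\mathbb{D}$ with $f(0)=0,f'(0)=1$. $f\prec g$ means $f=g\circ\omega$ for analytic $\omega:\mathbb{D}\to\mathbb{D}$, $\omega(0)=0$. $\wp(z)=1+ze^z$, $\mathscr{S}^*_\wp=\{f\in\mathcal{A}:zf'(z)/f(z)\prec\wp(z)\}$. *)

(* Defs.v *)
From Stdlib Require Import Reals.
From Coquelicot Require Import Coquelicot.
Open Scope R_scope.

Definition Cpow (z : C) (n : nat) : C := @pow_n C_Ring z n.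

Definition cexp (z : C) : C :=
  (exp (fst z) * cos (snd z), exp (fst z) * sin (snd z)).

Definition wp (z : C) : C := Cplus 1 (Cmult z (cexp z)).

Definition in_disk (z : C) : Prop := Cmod z < 1.

Definition analytic_disk_coef (g : C -> C) (a : nat -> C) : Prop :=
  forall z : C, in_disk z ->
    @is_series C_AbsRing C_NormedModule (fun k => Cmult (a k) (Cpow z k)) (g z).

Definition class_A (f : C -> C) (b : nat -> C) : Prop :=
  analytic_disk_coef f b /\ b 0%nat = 0 /\ b 1%nat = 1.

Definition schwarz (w : C -> C) : Prop :=
  (exists c : nat -> C, analytic_disk_coef w c) /\
  w 0 = 0 /\ forall z, in_disk z -> in_disk (w z).

(* z f'(z) / f(z) subordinate to wp: there is a Schwarz function w with
   z f'(z) / f(z) = wp (w z) on D (at z = 0 both sides are 1 by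
   convention; for z <> 0 we require f z <> 0 so the quotient is defined). *)
Definition starlike_wp (f : C -> C) : Prop :=
  exists w : C -> C, schwarz w /\
    forall z : C, in_disk z -> z <> 0 ->
      f z <> 0 /\
      exists d : C, @is_derive C_AbsRing C_NormedModule f z d /\
        Cdiv (Cmult z d) (f z) = wp (w z).

Definition H3_1 (b : nat -> C) : C :=
  b 3%nat * (b 2%nat * b 4%nat - b 3%nat * b 3%nat)
  - b 4%nat * (b 4%nat - b 2%nat * b 3%nat)
  + b 5%nat * (b 3%nat - b 2%nat * b 2%nat).

(* Main.v *)
Require Import Defs.
From Stdlib Require Import Reals Lra Lia.
From Coquelicot Require Import Coquelicot.
Open Scope R_scope.

(** Let [w] be the Schwarz function of [f], with coefficients [c_k].  Comparing
    coefficients in [z f'(z) = f(z) (1 + w(z) e^(w(z)))] expresses [b_2, ..., b_5]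
    through [c_1, ..., c_4], and turns the determinant into
    [144 H = -4 c1^6 + 5 c1^4 c2 - 25 c1^2 c2^2 + 9 c2^3 + 16 c1^3 c3 - 4 c1 c2 c3
    - 16 c3^2 + 18 c2 c4].
    Since [|w| < 1] on the disk, Bessel's inequality gives
    [|c1|^2 + |c2|^2 + |c3|^2 + |c4|^2 <= 1], and under this constraint alone the
    right-hand side is at most 21.25 in modulus, while 144 * 0.150627 > 21.69.

    Bessel's inequality comes from the discrete Fourier transform of a Taylor
    polynomial of [w] at roots of unity on a circle of radius [r < 1], letting the degree
    grow and then [r] tend to 1.  The comparison of coefficients uses asymptotic
    expansions along the positive real axis at 0, where [f'] is the term-by-term
    derivative by the theory of real power series applied to [Re f] and [Im f]. *)

(** * Power series on the disk *)

Lemma Cmod_le_fst_snd (z : C) : Cmod z <= Rabs (fst z) + Rabs (snd z).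
Proof.
  destruct z as [x y]; simpl.
  replace (x, y) with (RtoC x + Ci * RtoC y)%C
    by (unfold RtoC, Ci, Cplus, Cmult; simpl; f_equal; ring).
  eapply Rle_trans; [apply Cmod_triangle |].
  rewrite Cmod_mult, Cmod_Ci, !Cmod_R; lra.
Qed.

Lemma fst_sum_n (u : nat -> C) (n : nat) :
  fst (sum_n u n) = sum_n (fun k => fst (u k)) n.
Proof.
  induction n as [|n IH]; [now rewrite !sum_O |].
  rewrite !sum_Sn, <- IH; reflexivity.
Qed.

Lemma snd_sum_n (u : nat -> C) (n : nat) :
  snd (sum_n u n) = sum_n (fun k => snd (u k)) n.
Proof.
  induction n as [|n IH]; [now rewrite !sum_O |].
  rewrite !sum_Sn, <- IH; reflexivity.
Qed.

Lemma is_series_fst (u : nat -> C) (l : C) :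
  @is_series C_AbsRing C_NormedModule u l ->
  is_series (fun k => fst (u k)) (fst l).
Proof.
  intros H. unfold is_series.
  apply filterlim_ext with (fun n => fst (sum_n u n)); [intros n; apply fst_sum_n |].
  eapply filterlim_comp; [exact H |].
  intros P [e He]. exists e. intros y Hy. apply He. apply Hy.
Qed.

Lemma is_series_snd (u : nat -> C) (l : C) :
  @is_series C_AbsRing C_NormedModule u l ->
  is_series (fun k => snd (u k)) (snd l).
Proof.
  intros H. unfold is_series.
  apply filterlim_ext with (fun n => snd (sum_n u n)); [intros n; apply snd_sum_n |].
  eapply filterlim_comp; [exact H |].
  intros P [e He]. exists e. intros y Hy. apply He. apply Hy.
Qed.

Lemma is_series_pair (u : nat -> C) (l : C) :
  is_series (fun k => fst (u k)) (fst l) -> is_series (fun k => snd (u k)) (snd l) ->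
  @is_series C_AbsRing C_NormedModule u l.
Proof.
  intros H1 H2 P [e He].
  destruct (H1 _ (locally_ball (fst l) e)) as [N1 HN1].
  destruct (H2 _ (locally_ball (snd l) e)) as [N2 HN2].
  exists (max N1 N2). intros n Hn. apply He. split.
  - rewrite fst_sum_n. apply HN1. lia.
  - rewrite snd_sum_n. apply HN2. lia.
Qed.

Lemma is_series_bounded (u : nat -> R) (l : R) :
  is_series u l -> exists M, forall n, Rabs (u n) <= M.
Proof.
  intros H.
  assert (H0 : is_lim_seq u 0) by (apply ex_series_lim_0; now exists l).
  apply is_lim_seq_Reals in H0.
  destruct (maj_by_pos u (exist _ 0 H0)) as [M [_ HM]].
  now exists M.
Qed.

Lemma power_series_terms_bounded (a : nat -> C) (s : R) (l : C) : 0 < s ->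
  @is_series C_AbsRing C_NormedModule (fun k => a k * RtoC s ^ k)%C l ->
  exists M, forall k, Cmod (a k) * s ^ k <= M.
Proof.
  intros Hs Hg.
  destruct (is_series_bounded _ _ (is_series_fst _ _ Hg)) as [M1 H1].
  destruct (is_series_bounded _ _ (is_series_snd _ _ Hg)) as [M2 H2].
  exists (M1 + M2). intros k.
  assert (E : Cmod (a k * RtoC s ^ k)%C = Cmod (a k) * s ^ k).
  { rewrite Cmod_mult, Cmod_pow, Cmod_R, Rabs_pos_eq; [reflexivity | apply Rlt_le, Hs]. }
  rewrite <- E. specialize (H1 k). specialize (H2 k). cbv beta in H1, H2.
  apply Rle_trans with (1 := Cmod_le_fst_snd (a k * RtoC s ^ k)%C).
  now apply Rplus_le_compat.
Qed.

(** The difference of two partial sums is at most a finite geometric sum; letting the later index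
    grow replaces the later partial sum by the limit [l]. *)
Lemma geometric_tail_bound (u : nat -> C) (l : C) (M q : R) :
  0 <= q < 1 -> (forall k, Cmod (u k) <= M * q ^ k) ->
  @is_series C_AbsRing C_NormedModule u l ->
  forall n, Cmod (l - sum_n u n)%C <= M / (1 - q) * q ^ S n.
Proof.
  intros Hq Hu Hl n.
  assert (HM : 0 <= M).
  { specialize (Hu 0%nat). pose proof (Cmod_ge_0 (u 0%nat)). simpl in Hu. lra. }
  (* Keeping the negative term [q ^ S (n + m)] makes the bound telescope, so the induction on [m]
     closes; that term is dropped only at the end. *)
  assert (Hm : forall m, Cmod (sum_n u (n + m) - sum_n u n)%C
                 <= M / (1 - q) * (q ^ S n - q ^ S (n + m))).
  { induction m as [|m IH].
    - replace (n + 0)%nat with n by lia.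
      replace (sum_n u n - sum_n u n)%C with (RtoC 0) by ring.
      rewrite Cmod_0. apply Req_le. ring.
    - replace (n + S m)%nat with (S (n + m)) by lia. rewrite sum_Sn.
      change (plus (sum_n u (n + m)) (u (S (n + m)))) with
        (sum_n u (n + m) + u (S (n + m)))%C.
      replace (sum_n u (n + m) + u (S (n + m)) - sum_n u n)%C with
        ((sum_n u (n + m) - sum_n u n) + u (S (n + m)))%C by ring.
      eapply Rle_trans; [apply Cmod_triangle |].
      specialize (Hu (S (n + m))).
      replace (M / (1 - q) * (q ^ S n - q ^ S (S (n + m)))) with
        (M / (1 - q) * (q ^ S n - q ^ S (n + m)) + M * q ^ S (n + m))
        by (simpl; field; lra).
      lra. }
  apply le_epsilon. intros e He.
  assert (Hev := Hl _ (locally_ball_norm l (mkposreal e He))).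
  destruct Hev as [N HN].
  specialize (HN (n + N)%nat ltac:(lia)).
  change (Cmod (sum_n u (n + N) - l)%C < e) in HN.
  specialize (Hm N).
  replace (l - sum_n u n)%C with
    (- (sum_n u (n + N) - l) + (sum_n u (n + N) - sum_n u n))%C by ring.
  eapply Rle_trans; [apply Cmod_triangle |].
  rewrite Cmod_opp.
  assert (0 <= M / (1 - q)) by (apply Rdiv_le_0_compat; lra).
  assert (0 <= q ^ S (n + N)) by (apply pow_le; lra).
  assert (0 <= M / (1 - q) * q ^ S (n + N)) by now apply Rmult_le_pos.
  lra.
Qed.

Definition partial_poly (a : nat -> C) (n : nat) (z : C) : C :=
  sum_n (fun k => a k * z ^ k)%C n.

(** Convergence at [s] bounds [|a_k| s^k] by [M], which compares the series at [z] with a geometric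
    one of ratio [|z|/s]. As [M] depends on neither [z] nor [n], one constant serves a whole circle
    and all degrees. *)
Lemma partial_poly_tail (a : nat -> C) (s : R) (l0 : C) : 0 < s ->
  @is_series C_AbsRing C_NormedModule (fun k => a k * RtoC s ^ k)%C l0 ->
  exists M, 0 <= M /\ forall z l n, Cmod z < s ->
    @is_series C_AbsRing C_NormedModule (fun k => a k * z ^ k)%C l ->
    Cmod (l - partial_poly a n z)%C <= M / (1 - Cmod z / s) * (Cmod z / s) ^ S n.
Proof.
  intros Hs Hg.
  destruct (power_series_terms_bounded a s l0 Hs Hg) as [M HM].
  exists M. split.
  { specialize (HM 0%nat). pose proof (Cmod_ge_0 (a 0%nat)). simpl in HM. lra. }
  intros z l n Hz Hl. pose proof (Cmod_ge_0 z) as Hz0.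
  unfold partial_poly. apply geometric_tail_bound; [| | exact Hl].
  - split; [apply Rdiv_le_0_compat; lra |]. apply Rlt_div_l; lra.
  - intros k. rewrite Cmod_mult, Cmod_pow.
    unfold Rdiv. rewrite Rpow_mult_distr, pow_inv.
    assert (Hsk : 0 < s ^ k) by (apply pow_lt; lra).
    apply Rle_trans with ((Cmod (a k) * s ^ k) * (Cmod z ^ k * / s ^ k)).
    + apply Req_le. field. lra.
    + apply Rmult_le_compat_r; [| apply HM].
      apply Rdiv_le_0_compat; [apply pow_le |]; lra.
Qed.

(** * Bessel's inequality for Schwarz functions *)

(* The type of [sum_n u n] is [AbelianMonoid.sort _], which [ring] does not recognise as [C]. *)
Ltac Cring := match goal with |- @eq _ ?a ?b => change (@eq C a b); ring end.

Lemma Cmult_eq_0_r (u v : C) : u <> RtoC 0 -> (u * v)%C = RtoC 0 -> v = RtoC 0.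
Proof.
  intros Hu H. replace v with (/ u * (u * v))%C by (field; exact Hu).
  rewrite H. ring.
Qed.

Lemma sum_n_Sn_C (u : nat -> C) (n : nat) :
  sum_n u (S n) = (sum_n u n + u (S n))%C.
Proof. exact (sum_Sn u n). Qed.

Lemma sum_n_plus_C (u v : nat -> C) (n : nat) :
  sum_n (fun k => u k + v k)%C n = (sum_n u n + sum_n v n)%C.
Proof. exact (sum_n_plus u v n). Qed.

Lemma sum_n_mult_l_C (a : C) (u : nat -> C) (n : nat) :
  sum_n (fun k => a * u k)%C n = (a * sum_n u n)%C.
Proof. exact (@sum_n_mult_l C_Ring a u n). Qed.

Lemma sum_n_conj (u : nat -> C) (n : nat) :
  sum_n (fun k => Cconj (u k)) n = Cconj (sum_n u n).
Proof.
  induction n as [|n IH]; [now rewrite !sum_O |].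
  now rewrite !sum_n_Sn_C, IH, Cplus_conj.
Qed.

Lemma sum_n_RtoC (u : nat -> R) (n : nat) :
  sum_n (fun k => RtoC (u k)) n = RtoC (sum_n u n).
Proof.
  induction n as [|n IH]; [now rewrite !sum_O |].
  rewrite sum_n_Sn_C, IH, sum_Sn. now rewrite <- RtoC_plus.
Qed.

(** * Sums over roots of unity *)

Definition cis (x : R) : C := (cos x, sin x).

Lemma cis_plus (x y : R) : cis (x + y) = (cis x * cis y)%C.
Proof.
  unfold cis, Cmult; simpl. rewrite cos_plus, sin_plus. f_equal; ring.
Qed.

Lemma cis_0 : cis 0 = RtoC 1.
Proof. unfold cis. now rewrite cos_0, sin_0. Qed.

Lemma cis_conj (x : R) : Cconj (cis x) = cis (- x).
Proof. unfold cis, Cconj; simpl. now rewrite cos_neg, sin_neg. Qed.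

Lemma cis_mult_conj (x : R) : (cis x * Cconj (cis x))%C = RtoC 1.
Proof. rewrite cis_conj, <- cis_plus, Rplus_opp_r. exact cis_0. Qed.

Lemma Cmod_cis (x : R) : Cmod (cis x) = 1.
Proof.
  unfold Cmod, cis; simpl fst; simpl snd.
  replace (cos x ^ 2 + sin x ^ 2) with 1
    by (pose proof (sin2_cos2 x); unfold Rsqr in *; lra).
  apply sqrt_1.
Qed.

Lemma Cpow_cis (x : R) (k : nat) : (cis x ^ k)%C = cis (INR k * x).
Proof.
  induction k as [|k IH]; [simpl; rewrite Rmult_0_l; symmetry; exact cis_0 |].
  rewrite Cpow_S, IH, <- cis_plus, S_INR. f_equal. ring.
Qed.

Lemma cis_geometric (x : R) (n : nat) :
  ((cis x - 1) * sum_n (fun j => cis (INR j * x)) n)%C = (cis (INR (S n) * x) - 1)%C.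
Proof.
  induction n as [|n IH].
  - rewrite sum_O. simpl. rewrite Rmult_0_l, Rmult_1_l, cis_0. ring.
  - rewrite sum_n_Sn_C, Cmult_plus_distr_l, IH.
    rewrite (S_INR (S n)), Rmult_plus_distr_r, Rmult_1_l, cis_plus. ring.
Qed.

Lemma cis_period (m : nat) : cis (- (2 * INR m * PI)) = RtoC 1.
Proof.
  unfold cis. rewrite cos_neg, sin_neg.
  rewrite <- (Rplus_0_l (2 * INR m * PI)), cos_period, sin_period, cos_0, sin_0.
  unfold RtoC. f_equal. ring.
Qed.

(** By the half-angle formula, [cos x = 1] forces [sin (x / 2) = 0], while [- x / 2] lies strictly
    between 0 and [PI]. *)
Lemma cis_neq_1 (x : R) : - (2 * PI) < x < 0 -> cis x <> RtoC 1.
Proof.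
  intros Hx H. injection H as Hc Hs.
  assert (Hn : 0 < sin (- (x / 2))) by (apply sin_gt_0; lra).
  rewrite sin_neg in Hn.
  replace x with (2 * (x / 2)) in Hc by field.
  rewrite cos_2a_sin in Hc. nra.
Qed.

(** The summands form a geometric progression. Its ratio is not 1 because [0 < m < n + 1], yet the
    ratio raised to the power [n + 1] is 1. *)
Lemma roots_of_unity_sum (n m : nat) : (0 < m <= n)%nat ->
  sum_n (fun j => cis (INR j * (- INR m * (2 * PI / INR (S n))))) n = RtoC 0.
Proof.
  intros Hm. set (x := - INR m * (2 * PI / INR (S n))).
  assert (HS : 0 < INR (S n)) by (apply lt_0_INR; lia).
  pose proof PI_RGT_0 as Hpi.
  assert (H0 : 0 < INR m) by (apply lt_0_INR; lia).
  assert (H1 : INR m < INR (S n)) by (apply lt_INR; lia).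
  assert (Hx : - (2 * PI) < x < 0).
  { replace x with (- (2 * PI * (INR m / INR (S n)))) by (unfold x; field; lra).
    assert (0 < INR m / INR (S n)) by (apply Rdiv_lt_0_compat; lra).
    assert (INR m / INR (S n) < 1) by (apply Rlt_div_l; lra).
    split; nra. }
  pose proof (cis_geometric x n) as G.
  replace (INR (S n) * x) with (- (2 * INR m * PI)) in G by (unfold x; field; lra).
  rewrite cis_period in G.
  assert (Hne : (cis x - 1)%C <> RtoC 0).
  { intros E. apply (cis_neq_1 x Hx).
    replace (cis x) with ((cis x - 1) + 1)%C by ring. rewrite E. ring. }
  apply (Cmult_eq_0_r _ _ Hne). rewrite G. ring.
Qed.

(** * Parseval's identity for the discrete Fourier transform *)

Section Parseval.

Variables (a : nat -> C) (n : nat).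

Let theta := 2 * PI / INR (S n).
(** Value at the [j]-th of the [n + 1] roots of unity of the polynomial truncated at degree [m]. The
    degree is kept apart from [n] so that inductions can raise it while the nodes stay fixed. *)
Let P (m j : nat) : C := sum_n (fun k => a k * cis (INR j * (INR k * theta)))%C m.

(** A monomial of degree [k < l] contributes the frequency [-(l - k)], with [l - k] between 1 and
    [n], so its sum over the nodes vanishes. *)
Lemma parseval_cross (m l : nat) : (m < l <= n)%nat ->
  sum_n (fun j => P m j * Cconj (a l * cis (INR j * (INR l * theta))))%C n = RtoC 0.
Proof.
  intros Hl.
  assert (T : forall k, (k < l)%nat ->
    sum_n (fun j => (a k * cis (INR j * (INR k * theta)))
      * Cconj (a l * cis (INR j * (INR l * theta))))%C n = RtoC 0).
  { intros k Hk.
    rewrite (sum_n_ext _ (fun j => (a k * Cconj (a l)) *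
      cis (INR j * (- INR (l - k) * theta)))%C).
    - rewrite sum_n_mult_l_C. unfold theta.
      rewrite roots_of_unity_sum by lia. Cring.
    - intros j. rewrite Cmult_conj, cis_conj, minus_INR by lia.
      replace (INR j * (- (INR l - INR k) * theta)) with
        (INR j * (INR k * theta) + - (INR j * (INR l * theta))) by ring.
      rewrite cis_plus. Cring. }
  induction m as [|m IH].
  - rewrite (sum_n_ext _ (fun j => (a O * cis (INR j * (INR O * theta)))
      * Cconj (a l * cis (INR j * (INR l * theta))))%C).
    + apply T; lia.
    + intros j. unfold P. now rewrite sum_O.
  - rewrite (sum_n_ext _ (fun j => P m j * Cconj (a l * cis (INR j * (INR l * theta)))
      + (a (S m) * cis (INR j * (INR (S m) * theta)))
      * Cconj (a l * cis (INR j * (INR l * theta))))%C).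
    + rewrite sum_n_plus_C, IH, T by lia. Cring.
    + intros j. unfold P. rewrite sum_n_Sn_C. Cring.
Qed.

Lemma parseval_C (m : nat) : (m <= n)%nat ->
  sum_n (fun j => P m j * Cconj (P m j))%C n
  = (INR (S n) * sum_n (fun k => a k * Cconj (a k)) m)%C.
Proof.
  assert (D : forall k,
    sum_n (fun j => (a k * cis (INR j * (INR k * theta)))
      * Cconj (a k * cis (INR j * (INR k * theta))))%C n
    = (INR (S n) * (a k * Cconj (a k)))%C).
  { intros k.
    rewrite (sum_n_ext _ (fun j => (a k * Cconj (a k)) * RtoC 1)%C).
    - rewrite sum_n_mult_l_C, (sum_n_RtoC (fun _ => 1)), sum_n_const, Rmult_1_r. Cring.
    - intros j. rewrite Cmult_conj, <- (cis_mult_conj (INR j * (INR k * theta))). Cring. }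
  induction m as [|m IH]; intros Hm.
  - rewrite sum_O, <- D. apply sum_n_ext. intros j. unfold P. now rewrite sum_O.
  (* With [q] the new monomial, [|P + q|^2] splits into [|P|^2], the cross term, its conjugate and
     [|q|^2]; both cross sums vanish. *)
  - rewrite (sum_n_ext _ (fun j => P m j * Cconj (P m j)
      + (P m j * Cconj (a (S m) * cis (INR j * (INR (S m) * theta)))
      + (Cconj (P m j * Cconj (a (S m) * cis (INR j * (INR (S m) * theta))))
      + (a (S m) * cis (INR j * (INR (S m) * theta)))
      * Cconj (a (S m) * cis (INR j * (INR (S m) * theta))))))%C).
    + rewrite !sum_n_plus_C, sum_n_conj, parseval_cross, D, IH by lia.
      rewrite sum_n_Sn_C.
      replace (Cconj (RtoC 0)) with (RtoC 0)
        by (unfold Cconj, RtoC; simpl; f_equal; ring).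
      Cring.
    + intros j. unfold P. rewrite sum_n_Sn_C, Cplus_conj, (Cmult_conj _ (Cconj _)), Cconj_conj. Cring.
Qed.

Lemma parseval :
  sum_n (fun j => Cmod (P n j) ^ 2) n = INR (S n) * sum_n (fun k => Cmod (a k) ^ 2) n.
Proof.
  apply RtoC_inj. rewrite RtoC_mult, <- !sum_n_RtoC.
  etransitivity; [| etransitivity; [exact (parseval_C n (le_n n)) |]].
  - apply sum_n_ext. intros j. apply Cmod2_conj.
  - f_equal. apply sum_n_ext. intros k. symmetry. apply Cmod2_conj.
Qed.

End Parseval.

Lemma sum_n_le_const (u : nat -> R) (B : R) (n : nat) :
  (forall k, u k <= B) -> sum_n u n <= INR (S n) * B.
Proof.
  intros H. rewrite <- sum_n_const, !sum_n_Reals. apply sum_Rle. intros k _. apply H.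
Qed.

Lemma schwarz_coef_sum_radius (w : C -> C) (c : nat -> C) (r : R) (N : nat) :
  analytic_disk_coef w c -> (forall z, in_disk z -> in_disk (w z)) -> 0 < r < 1 ->
  sum_n (fun k => (Cmod (c k) * r ^ k) ^ 2) N <= 1.
Proof.
  intros Hw Hd Hr.
  (* Any radius strictly between [r] and 1 works: on the circle of radius [r] the tail of the series
     then decays with ratio [r / s < 1]. *)
  set (s := (1 + r) / 2).
  assert (Hs : 0 < s < 1) by (unfold s; lra).
  destruct (partial_poly_tail c s (w (RtoC s)) (proj1 Hs)) as [M [HM0 HM]].
  { apply Hw. unfold in_disk. rewrite Cmod_R, Rabs_pos_eq; lra. }
  set (q := r / s) in *.
  assert (Hq : 0 <= q < 1).
  { unfold q; split; [apply Rdiv_le_0_compat; unfold s; lra |].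
    apply Rlt_div_l; unfold s; lra. }
  apply le_epsilon. intros d Hd0.
  set (K := M / (1 - q) + 1).
  assert (HK : 0 <= M / (1 - q)) by (apply Rdiv_le_0_compat; lra).
  (* With [e <= 1] and [e <= d / 3], [(1 + e)^2 <= 1 + 3 e <= 1 + d]. *)
  set (e := Rmin 1 (d / 3)).
  assert (He : 0 < e) by (apply Rmin_glb_lt; lra).
  destruct (pow_lt_1_zero q ltac:(rewrite Rabs_pos_eq; lra) (e / K)
    ltac:(apply Rdiv_lt_0_compat; unfold K; lra)) as [N0 HN0].
  set (n := (N + N0)%nat).
  assert (Htail : M / (1 - q) * q ^ S n <= e).
  { specialize (HN0 (S n) ltac:(unfold n; lia)).
    assert (0 <= q ^ S n) by (apply pow_le; lra).
    rewrite Rabs_pos_eq in HN0 by lra.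
    apply Rlt_div_r in HN0; [| unfold K; lra]. unfold K in HN0. nra. }
  (* The factor [r ^ k] moves the nodes to the circle of radius [r], where the Taylor polynomial of
     degree [n] is at most [1 + e] in modulus. *)
  pose proof (parseval (fun k => c k * RtoC (r ^ k))%C n) as HP. cbv beta zeta in HP.
  assert (HB : INR (S n) * sum_n (fun k => (Cmod (c k) * r ^ k) ^ 2) n
    <= INR (S n) * (1 + d)).
  { rewrite (sum_n_ext _ (fun k => Cmod (c k * RtoC (r ^ k))%C ^ 2)).
    2:{ intros k. rewrite Cmod_mult, Cmod_R, Rabs_pos_eq; [reflexivity |].
        apply pow_le; lra. }
    rewrite <- HP. apply sum_n_le_const. intros j.
    set (z := (RtoC r * cis (INR j * (2 * PI / INR (S n))))%C).
    assert (Hz : Cmod z = r).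
    { unfold z. rewrite Cmod_mult, Cmod_cis, Cmod_R, Rabs_pos_eq; lra. }
    rewrite (sum_n_ext _ (fun k => c k * z ^ k)%C).
    2:{ intros k. rewrite <- Cmult_assoc. f_equal. unfold z.
        rewrite RtoC_pow.
        replace (INR j * (INR k * (2 * PI / INR (S n)))) with
          (INR k * (INR j * (2 * PI / INR (S n)))) by ring.
        rewrite <- Cpow_cis, Cpow_mult_l. reflexivity. }
    change (Cmod (partial_poly c n z) ^ 2 <= 1 + d).
    assert (Hlt : Cmod (w z) < 1) by (apply Hd; unfold in_disk; lra).
    specialize (HM z (w z) n ltac:(rewrite Hz; unfold s; lra)
      ltac:(apply Hw; unfold in_disk; lra)). rewrite Hz in HM. fold q in HM.
    assert (Hle : Cmod (partial_poly c n z) <= 1 + e).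
    { replace (partial_poly c n z) with (w z + - (w z - partial_poly c n z))%C by ring.
      eapply Rle_trans; [apply Cmod_triangle |]. rewrite Cmod_opp. lra. }
    pose proof (Cmod_ge_0 (partial_poly c n z)).
    assert (e <= 1) by apply Rmin_l.
    assert (e <= d / 3) by apply Rmin_r.
    nra. }
  apply Rmult_le_reg_l in HB; [| apply lt_0_INR; lia].
  eapply Rle_trans; [| exact HB].
  (* The terms beyond index [N] are squares, so dropping them only lowers the sum. *)
  rewrite !sum_n_Reals. unfold n. clear.
  induction N0 as [|N0 IH]; [rewrite Nat.add_0_r; apply Rle_refl |].
  rewrite Nat.add_succ_r, tech5.
  pose proof (pow2_ge_0 (Cmod (c (S (N + N0))) * r ^ S (N + N0))). lra.
Qed.

Lemma schwarz_coef_bessel (w : C -> C) (c : nat -> C) :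
  analytic_disk_coef w c -> (forall z, in_disk z -> in_disk (w z)) ->
  Cmod (c 1%nat) ^ 2 + Cmod (c 2%nat) ^ 2 + Cmod (c 3%nat) ^ 2 + Cmod (c 4%nat) ^ 2 <= 1.
Proof.
  intros Hw Hd.
  set (S0 := _ + Cmod (c 4%nat) ^ 2).
  (* Among the weights [r^(2k)] with [k <= 4] the smallest is [r^8]. *)
  assert (H : forall r, 0 < r < 1 -> r ^ 8 * S0 <= 1).
  { intros r Hr. pose proof (schwarz_coef_sum_radius w c r 4 Hw Hd Hr) as B.
    rewrite sum_n_Reals, !tech5 in B. change (sum_f_R0 _ 0) with ((Cmod (c O) * r ^ 0) ^ 2) in B.
    assert (E : forall k, (k <= 4)%nat ->
      r ^ 8 * Cmod (c k) ^ 2 <= (Cmod (c k) * r ^ k) ^ 2).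
    { intros k Hk. rewrite Rpow_mult_distr, <- pow_mult, Rmult_comm.
      apply Rmult_le_compat_l; [apply pow2_ge_0 |].
      replace 8%nat with (k * 2 + (8 - k * 2))%nat by lia.
      rewrite pow_add. rewrite <- (Rmult_1_r (r ^ (k * 2))) at 2.
      apply Rmult_le_compat_l; [apply pow_le; lra |].
      rewrite <- (pow1 (8 - k * 2)). apply pow_incr. lra. }
    pose proof (E 1%nat ltac:(lia)). pose proof (E 2%nat ltac:(lia)).
    pose proof (E 3%nat ltac:(lia)). pose proof (E 4%nat ltac:(lia)).
    pose proof (pow2_ge_0 (Cmod (c O) * r ^ 0)).
    unfold S0. rewrite !Rmult_plus_distr_l. lra. }
  destruct (Rle_or_lt S0 1) as [|Hgt]; [assumption |].
  exfalso.
  (* Chosen so that [(1 - h)^8 >= 1 - 8 h = (1 + 1 / S0) / 2]; multiplied by [S0] this is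
     [(S0 + 1) / 2], which exceeds 1 if [S0] does. *)
  set (h := (1 - / S0) / 16).
  assert (HS : 0 < / S0) by (apply Rinv_0_lt_compat; lra).
  assert (HS1 : / S0 < 1) by (rewrite <- Rinv_1; apply Rinv_lt_contravar; lra).
  assert (Hh : 0 < h < 1 / 16) by (unfold h; lra).
  specialize (H (1 - h) ltac:(lra)).
  assert (B2 : 1 - 2 * h <= (1 - h) ^ 2) by nra.
  assert (B4 : 1 - 4 * h <= (1 - h) ^ 4) by nra.
  assert (B8 : 1 - 8 * h <= (1 - h) ^ 8) by nra.
  assert (HSS : / S0 * S0 = 1) by (field; lra).
  assert (H8 : (1 - 8 * h) * S0 <= 1).
  { eapply Rle_trans; [apply Rmult_le_compat_r; [lra | exact B8] | exact H]. }
  replace ((1 - 8 * h) * S0) with ((S0 + / S0 * S0) / 2) in H8 by (unfold h; field; lra).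
  lra.
Qed.

(** * Asymptotic expansions at 0 *)

(* The estimate is one-sided, for [t] tending to 0 from above. *)
Definition bigO (n : nat) (F : R -> C) : Prop :=
  exists M d, 0 <= M /\ 0 < d /\ forall t, 0 < t < d -> Cmod (F t) <= M * t ^ n.

Lemma bigO_ext (n : nat) (F G : R -> C) (d : R) :
  0 < d -> (forall t, 0 < t < d -> F t = G t) -> bigO n F -> bigO n G.
Proof.
  intros Hd H [M [e [HM [He HF]]]]. exists M, (Rmin d e).
  repeat split; [assumption | now apply Rmin_glb_lt |].
  intros t Ht. pose proof (Rmin_l d e). pose proof (Rmin_r d e).
  rewrite <- H by lra. apply HF; lra.
Qed.

Lemma bigO_plus (n : nat) (F G : R -> C) :
  bigO n F -> bigO n G -> bigO n (fun t => F t + G t)%C.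
Proof.
  intros [M [d [HM [Hd HF]]]] [M' [d' [HM' [Hd' HG]]]].
  exists (M + M'), (Rmin d d').
  repeat split; [lra | now apply Rmin_glb_lt |].
  intros t Ht. pose proof (Rmin_l d d'). pose proof (Rmin_r d d').
  eapply Rle_trans; [apply Cmod_triangle |].
  specialize (HF t ltac:(lra)). specialize (HG t ltac:(lra)). lra.
Qed.

Lemma bigO_mult (n m : nat) (F G : R -> C) :
  bigO n F -> bigO m G -> bigO (n + m) (fun t => F t * G t)%C.
Proof.
  intros [M [d [HM [Hd HF]]]] [M' [d' [HM' [Hd' HG]]]].
  exists (M * M'), (Rmin d d').
  repeat split; [now apply Rmult_le_pos | now apply Rmin_glb_lt |].
  intros t Ht. pose proof (Rmin_l d d'). pose proof (Rmin_r d d').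
  rewrite Cmod_mult, pow_add.
  replace (M * M' * (t ^ n * t ^ m)) with ((M * t ^ n) * (M' * t ^ m)) by ring.
  apply Rmult_le_compat; try apply Cmod_ge_0; [apply HF | apply HG]; lra.
Qed.

Lemma bigO_le (n m : nat) (F : R -> C) : (m <= n)%nat -> bigO n F -> bigO m F.
Proof.
  intros Hm [M [d [HM [Hd HF]]]]. exists M, (Rmin d 1).
  repeat split; [assumption | apply Rmin_glb_lt; lra |].
  intros t Ht. pose proof (Rmin_l d 1). pose proof (Rmin_r d 1).
  eapply Rle_trans; [apply HF; lra |]. apply Rmult_le_compat_l; [assumption |].
  replace n with (m + (n - m))%nat by lia. rewrite pow_add.
  rewrite <- (Rmult_1_r (t ^ m)) at 2.
  apply Rmult_le_compat_l; [apply pow_le; lra |].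
  rewrite <- (pow1 (n - m)). apply pow_incr. lra.
Qed.

Lemma bigO_const (a : C) : bigO 0 (fun _ => a).
Proof.
  exists (Cmod a), 1. repeat split; [apply Cmod_ge_0 | lra |].
  intros t _. simpl. lra.
Qed.

Lemma bigO_RtoC : bigO 1 RtoC.
Proof.
  exists 1, 1. repeat split; [lra | lra |].
  intros t Ht. rewrite Cmod_R, Rabs_pos_eq; simpl; lra.
Qed.

Lemma bigO_scal (n : nat) (a : C) (F : R -> C) : bigO n F -> bigO n (fun t => a * F t)%C.
Proof. apply (bigO_mult 0 n); apply bigO_const. Qed.

Lemma bigO_minus (n : nat) (F G : R -> C) :
  bigO n F -> bigO n G -> bigO n (fun t => F t - G t)%C.
Proof.
  intros HF HG. apply (bigO_ext n (fun t => F t + (- (1)) * G t)%C _ 1); [lra | |].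
  - intros t _. ring.
  - apply bigO_plus; [assumption | now apply bigO_scal].
Qed.

Lemma bigO_const_eq_0 (a : C) : bigO 1 (fun _ => a) -> a = RtoC 0.
Proof.
  intros [M [d [HM [Hd H]]]]. apply Cmod_eq_0.
  apply Rle_antisym; [| apply Cmod_ge_0].
  apply le_epsilon. intros e He.
  set (t := Rmin (d / 2) (e / (M + 1))).
  assert (Ht : 0 < t) by (apply Rmin_glb_lt; [| apply Rdiv_lt_0_compat]; lra).
  assert (H1 : t <= d / 2) by apply Rmin_l.
  assert (H2 : t <= e / (M + 1)) by apply Rmin_r.
  specialize (H t ltac:(lra)). simpl in H.
  apply Rle_div_r in H2; [| lra]. nra.
Qed.

Lemma bigO_div_RtoC (n : nat) (F : R -> C) :
  bigO (S n) (fun t => RtoC t * F t)%C -> bigO n F.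
Proof.
  intros [M [d [HM [Hd H]]]]. exists M, d. repeat split; try assumption.
  intros t Ht. specialize (H t Ht).
  rewrite Cmod_mult, Cmod_R, Rabs_pos_eq in H by lra. simpl in H.
  apply (Rmult_le_reg_l t); lra.
Qed.

(** Four coefficients suffice: the comparison is made for [(f' - f/z)/z], whose expansion starts
    [b_2, 2 b_3, 3 b_4, 4 b_5]. *)
Definition jet (F : R -> C) (a0 a1 a2 a3 : C) : Prop :=
  bigO 4 (fun t => F t - (a0 + RtoC t * (a1 + RtoC t * (a2 + RtoC t * a3))))%C.

Ltac solve_bigO0 := repeat first
  [ assumption | apply bigO_const | apply (bigO_le 1 0 _ (le_S _ _ (le_n 0)) bigO_RtoC)
  | apply (bigO_plus 0) | apply (bigO_mult 0 0) | apply (bigO_minus 0) ].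

Lemma jet_ext (F G : R -> C) (a0 a1 a2 a3 : C) (d : R) :
  0 < d -> (forall t, 0 < t < d -> F t = G t) -> jet F a0 a1 a2 a3 -> jet G a0 a1 a2 a3.
Proof.
  intros Hd H. apply bigO_ext with d; [assumption |].
  intros t Ht. now rewrite H.
Qed.

Lemma jet_bigO (F G : R -> C) (a0 a1 a2 a3 : C) :
  bigO 4 (fun t => F t - G t)%C -> jet G a0 a1 a2 a3 -> jet F a0 a1 a2 a3.
Proof.
  intros H1 H2. eapply (bigO_ext 4 _ _ 1); [lra | | exact (bigO_plus 4 _ _ H1 H2)].
  intros t _. cbv beta. ring.
Qed.

Lemma jet_bounded (F : R -> C) (a0 a1 a2 a3 : C) : jet F a0 a1 a2 a3 -> bigO 0 F.
Proof.
  intros H. apply (bigO_le 4 0) in H; [| lia].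
  eapply (bigO_ext 0 _ _ 1); [lra | |].
  2:{ refine (bigO_plus 0 _ (fun t => a0 + RtoC t * (a1 + RtoC t * (a2 + RtoC t * a3)))%C
        H _). solve_bigO0. }
  intros t _. cbv beta. ring.
Qed.

Lemma jet_const (a : C) : jet (fun _ => a) a 0 0 0.
Proof.
  exists 0, 1. repeat split; [lra | lra |]. intros t _.
  replace (a - _)%C with (RtoC 0) by ring. rewrite Cmod_0. lra.
Qed.

Lemma jet_plus (F G : R -> C) (a0 a1 a2 a3 b0 b1 b2 b3 : C) :
  jet F a0 a1 a2 a3 -> jet G b0 b1 b2 b3 ->
  jet (fun t => F t + G t)%C (a0 + b0) (a1 + b1) (a2 + b2) (a3 + b3).
Proof.
  intros HF HG. eapply (bigO_ext 4 _ _ 1); [lra | | exact (bigO_plus 4 _ _ HF HG)].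
  intros t _. cbv beta. ring.
Qed.

Lemma jet_mult (F G : R -> C) (a0 a1 a2 a3 b0 b1 b2 b3 : C) :
  jet F a0 a1 a2 a3 -> jet G b0 b1 b2 b3 ->
  jet (fun t => F t * G t)%C (a0 * b0) (a0 * b1 + a1 * b0)
    (a0 * b2 + a1 * b1 + a2 * b0) (a0 * b3 + a1 * b2 + a2 * b1 + a3 * b0).
Proof.
  intros HF HG.
  (* The terms of degree 4 to 6 in the product of the two cubics [p] and [q]. The remaining error is
     [(F - p) G + p (G - q)], small because [G] and [p] are bounded. *)
  assert (HT : bigO 4 (fun t => (RtoC t * (RtoC t * (RtoC t * RtoC t))) *
    ((a1 * b3 + a2 * b2 + a3 * b1) + RtoC t * ((a2 * b3 + a3 * b2)
     + RtoC t * (a3 * b3))))%C).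
  { apply (bigO_mult 4 0); [| solve_bigO0].
    repeat apply (bigO_mult 1 _ RtoC); apply bigO_RtoC. }
  assert (HB := jet_bounded _ _ _ _ _ HG).
  eapply (bigO_ext 4 _ _ 1); [lra | |
    exact (bigO_plus 4 _ _ HT (bigO_plus 4 _ _ (bigO_mult 4 0 _ _ HF HB)
      (bigO_mult 0 4 (fun t => a0 + RtoC t * (a1 + RtoC t * (a2 + RtoC t * a3)))%C _
         ltac:(solve_bigO0) HG)))].
  intros t _. cbv beta. ring.
Qed.

Lemma jet_unique (F : R -> C) (a0 a1 a2 a3 b0 b1 b2 b3 : C) :
  jet F a0 a1 a2 a3 -> jet F b0 b1 b2 b3 ->
  a0 = b0 /\ a1 = b1 /\ a2 = b2 /\ a3 = b3.
Proof.
  intros HF HG.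
  (* Peels off the constant term, which must vanish as [t] tends to 0, and divides the rest by [t].
     Repeating this on the difference of the two cubics identifies the coefficients in turn. *)
  assert (K : forall (n : nat) (a : C) (G : R -> C), bigO 0 G ->
    bigO (S n) (fun t => a + RtoC t * G t)%C -> a = RtoC 0 /\ bigO n G).
  { intros n a G H0 H.
    assert (a = RtoC 0).
    { apply bigO_const_eq_0.
      eapply (bigO_ext 1 _ _ 1); [lra | | exact (bigO_minus 1 _ _
        (bigO_le (S n) 1 _ ltac:(lia) H) (bigO_mult 1 0 _ _ bigO_RtoC H0))].
      intros t _. cbv beta. ring. }
    split; [assumption |]. apply bigO_div_RtoC.
    eapply (bigO_ext _ _ _ 1); [lra | | exact H].
    intros t _. cbv beta. rewrite H1. ring. }
  assert (H : bigO 4 (fun t => (a0 - b0) + RtoC t * ((a1 - b1)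
    + RtoC t * ((a2 - b2) + RtoC t * (a3 - b3))))%C).
  { eapply (bigO_ext 4 _ _ 1); [lra | | exact (bigO_minus 4 _ _ HG HF)].
    intros t _. cbv beta. ring. }
  apply K in H; [| solve_bigO0]. destruct H as [E0 H].
  apply K in H; [| solve_bigO0]. destruct H as [E1 H].
  apply K in H; [| solve_bigO0]. destruct H as [E2 H].
  apply bigO_const_eq_0 in H.
  assert (Z : forall x y : C, (x - y)%C = RtoC 0 -> x = y).
  { intros x y E. replace x with ((x - y) + y)%C by ring. rewrite E. ring. }
  repeat split; now apply Z.
Qed.

Lemma jet_cubic (F : R -> C) (a1 a2 a3 k0 k1 k2 k3 : C) : jet F 0 a1 a2 a3 ->
  jet (fun t => k0 + F t * (k1 + F t * (k2 + F t * k3)))%C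
    k0 (k1 * a1) (k1 * a2 + k2 * (a1 * a1))
    (k1 * a3 + RtoC 2 * k2 * (a1 * a2) + k3 * (a1 * a1 * a1)).
Proof.
  intros HF.
  pose proof (jet_plus _ _ _ _ _ _ _ _ _ _ (jet_const k0) (jet_mult _ _ _ _ _ _ _ _ _ _ HF
    (jet_plus _ _ _ _ _ _ _ _ _ _ (jet_const k1) (jet_mult _ _ _ _ _ _ _ _ _ _ HF
    (jet_plus _ _ _ _ _ _ _ _ _ _ (jet_const k2) (jet_mult _ _ _ _ _ _ _ _ _ _ HF
      (jet_const k3))))))) as H. cbv beta in H.
  match type of H with jet _ ?x0 ?x1 ?x2 ?x3 =>
    replace x0 with k0 in H by ring;
    replace x1 with (k1 * a1)%C in H by ring;
    replace x2 with (k1 * a2 + k2 * (a1 * a1))%C in H by ring;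
    replace x3 with (k1 * a3 + RtoC 2 * k2 * (a1 * a2) + k3 * (a1 * a1 * a1))%C in H by ring
  end. exact H.
Qed.

Lemma jet_bigO_1 (F : R -> C) (a1 a2 a3 : C) : jet F 0 a1 a2 a3 -> bigO 1 F.
Proof.
  intros H. apply (bigO_le 4 1) in H; [| lia].
  eapply (bigO_ext 1 _ _ 1); [lra | |].
  2:{ refine (bigO_plus 1 _ (fun t => RtoC t * (a1 + RtoC t * (a2 + RtoC t * a3)))%C H _).
      apply (bigO_mult 1 0); [apply bigO_RtoC | solve_bigO0]. }
  intros t _. cbv beta. ring.
Qed.

(** * Expansion of the complex exponential through real functions *)

Lemma jet_fst (F : R -> C) (a0 a1 a2 a3 : C) : jet F a0 a1 a2 a3 ->
  jet (fun t => RtoC (fst (F t))) (RtoC (fst a0)) (RtoC (fst a1)) (RtoC (fst a2)) (RtoC (fst a3)).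
Proof.
  intros [M [d [HM [Hd H]]]]. exists M, d. repeat split; try assumption.
  intros t Ht. eapply Rle_trans; [| exact (H t Ht)].
  eapply Rle_trans; [| apply re_le_Cmod]. rewrite <- Cmod_R. right. f_equal.
  destruct (F t), a0, a1, a2, a3.
  apply injective_projections; unfold Re; simpl; ring.
Qed.

Lemma jet_snd (F : R -> C) (a0 a1 a2 a3 : C) : jet F a0 a1 a2 a3 ->
  jet (fun t => RtoC (snd (F t))) (RtoC (snd a0)) (RtoC (snd a1)) (RtoC (snd a2)) (RtoC (snd a3)).
Proof.
  intros [M [d [HM [Hd H]]]]. exists M, d. repeat split; try assumption.
  intros t Ht. eapply Rle_trans; [| exact (H t Ht)].
  eapply Rle_trans; [| eapply Rle_trans; [apply Rmax_r | apply Rmax_Cmod]].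
  rewrite <- Cmod_R. right. f_equal.
  destruct (F t), a0, a1, a2, a3.
  apply injective_projections; simpl; ring.
Qed.

(** Since [u] has no constant term it is O(t), so the Taylor remainder [K |u|^4] of [phi] is O(t^4),
    and only the cubic Taylor polynomial of [phi] matters. *)
Lemma jet_real_comp (phi u : R -> R) (k0 k1 k2 k3 K e : R) (a1 a2 a3 : C) :
  0 <= K -> 0 < e ->
  (forall x, Rabs x <= e ->
    Rabs (phi x - (k0 + x * (k1 + x * (k2 + x * k3)))) <= K * Rabs x ^ 4) ->
  jet (fun t => RtoC (u t)) 0 a1 a2 a3 ->
  jet (fun t => RtoC (phi (u t)))
    k0 (k1 * a1) (k1 * a2 + k2 * (a1 * a1))
    (k1 * a3 + RtoC 2 * k2 * (a1 * a2) + k3 * (a1 * a1 * a1)).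
Proof.
  intros HK He Hphi Hu.
  eapply jet_bigO; [| exact (jet_cubic _ _ _ _ k0 k1 k2 k3 Hu)].
  destruct (jet_bigO_1 _ _ _ _ Hu) as [M [d [HM [Hd H]]]].
  exists (K * M ^ 4), (Rmin d (e / (M + 1))).
  repeat split.
  - apply Rmult_le_pos; [assumption | now apply pow_le].
  - apply Rmin_glb_lt; [assumption | apply Rdiv_lt_0_compat; lra].
  - intros t Ht.
    assert (H1 : t < d) by (eapply Rlt_le_trans; [apply Ht | apply Rmin_l]).
    assert (H2 : t < e / (M + 1)) by (eapply Rlt_le_trans; [apply Ht | apply Rmin_r]).
    apply Rlt_div_r in H2; [| lra].
    specialize (H t ltac:(lra)). rewrite Cmod_R, pow_1 in H.
    repeat rewrite <- ?RtoC_mult, <- ?RtoC_plus. rewrite <- RtoC_minus, Cmod_R.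
    eapply Rle_trans; [apply Hphi; nra |].
    rewrite Rmult_assoc, <- Rpow_mult_distr.
    apply Rmult_le_compat_l; [assumption |].
    apply pow_incr. split; [apply Rabs_pos | assumption].
Qed.

(** The exponential series has terms at most [|x|^k], so its tail is geometric; the constant 2
    bounds [1 / (1 - |x|)]. *)
Lemma exp_cubic_bound (x : R) : Rabs x <= 1 / 2 ->
  Rabs (exp x - (1 + x * (1 + x * (1 / 2 + x * (1 / 6))))) <= 2 * Rabs x ^ 4.
Proof.
  intros Hx. pose proof (Rabs_pos x) as H0.
  pose proof (geometric_tail_bound (fun k => RtoC (x ^ k * / INR (Factorial.fact k)))
    (RtoC (exp x)) 1 (Rabs x) ltac:(lra)) as H.
  assert (Hk : forall k, Cmod (RtoC (x ^ k * / INR (Factorial.fact k))) <= 1 * Rabs x ^ k).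
  { intros k. rewrite Cmod_R, Rabs_mult, <- RPow_abs, Rmult_1_l.
    rewrite <- (Rmult_1_r (Rabs x ^ k)) at 2.
    apply Rmult_le_compat_l; [now apply pow_le |].
    assert (1 <= INR (Factorial.fact k)) by (apply (le_INR 1), Factorial.lt_O_fact).
    rewrite Rabs_pos_eq by (apply Rlt_le, Rinv_0_lt_compat; lra).
    rewrite <- Rinv_1. apply Rinv_le_contravar; lra. }
  specialize (H Hk). clear Hk.
  assert (Hs : @is_series C_AbsRing C_NormedModule
    (fun k => RtoC (x ^ k * / INR (Factorial.fact k))) (RtoC (exp x))).
  { apply is_series_pair; simpl.
    - eapply is_series_ext; [| apply (proj1 (is_pseries_R _ _ _) (is_exp_Reals x))].
      intros k. simpl. apply Rmult_comm.
    - apply filterlim_ext with (fun _ : nat => 0); [| apply filterlim_const].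
      intros n. rewrite sum_n_const. ring. }
  specialize (H Hs 3%nat). rewrite sum_n_RtoC, <- RtoC_minus, Cmod_R in H.
  rewrite sum_n_Reals, !tech5 in H.
  change (sum_f_R0 (fun k : nat => x ^ k * / INR (Factorial.fact k)) 0)
    with (x ^ 0 * / INR (Factorial.fact 0)) in H.
  replace (x ^ 0 * / INR (Factorial.fact 0) + x ^ 1 * / INR (Factorial.fact 1) + x ^ 2 * / INR (Factorial.fact 2)
    + x ^ 3 * / INR (Factorial.fact 3)) with (1 + x * (1 + x * (1 / 2 + x * (1 / 6)))) in H
    by (simpl; field).
  eapply Rle_trans; [exact H |].
  apply Rmult_le_compat_r; [now apply pow_le |].
  apply Rle_div_l; lra.
Qed.

(** The alternating Taylor bounds place [cos x] between [1 - x^2/2] and [1 - x^2/2 + x^4/24]. *)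
Lemma cos_cubic_bound (x : R) : Rabs x <= 1 / 2 ->
  Rabs (cos x - (1 + x * (0 + x * (- (1 / 2) + x * 0)))) <= 1 * Rabs x ^ 4.
Proof.
  intros Hx. apply Rabs_le_between in Hx.
  pose proof PI2_1.
  pose proof (cos_bound x 0 ltac:(lra) ltac:(lra)) as H1.
  unfold cos_approx, cos_term in H1. simpl in H1.
  assert (0 <= x ^ 4) by nra.
  rewrite RPow_abs, (Rabs_pos_eq (x ^ 4)) by assumption. simpl in *.
  apply Rabs_le. lra.
Qed.

(** For [x >= 0] the alternating Taylor bounds leave an error of at most [x^5/120], hence at most
    [x^4]; oddness covers [x < 0]. *)
Lemma sin_cubic_bound (x : R) : Rabs x <= 1 / 2 ->
  Rabs (sin x - (0 + x * (1 + x * (0 + x * (- (1 / 6)))))) <= 1 * Rabs x ^ 4.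
Proof.
  pose proof PI2_1 as HPI.
  assert (K : forall y, 0 <= y <= 1 / 2 ->
    Rabs (sin y - (0 + y * (1 + y * (0 + y * (- (1 / 6)))))) <= y ^ 4).
  { intros y Hy.
    pose proof (sin_bound y 0 ltac:(lra) ltac:(lra)) as H1.
    unfold sin_approx, sin_term in H1. simpl in H1.
    assert (Hy4 : 0 <= y ^ 4) by (apply pow_le; lra).
    assert (Hy5 : y ^ 5 <= y ^ 4) by (simpl in *; nra).
    assert (0 <= y ^ 5) by (apply pow_le; lra).
    simpl in *. apply Rabs_le. lra. }
  intros Hx. rewrite Rmult_1_l.
  destruct (Rle_or_lt 0 x) as [H0 | H0].
  - rewrite (Rabs_pos_eq x) in * by assumption. apply K. lra.
  - rewrite (Rabs_left x) in * by assumption. 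
    specialize (K (- x) ltac:(lra)). rewrite sin_neg in K.
    rewrite <- Rabs_Ropp.
    replace (- (sin x - (0 + x * (1 + x * (0 + x * - (1 / 6)))))) with
      (- sin x - (0 + - x * (1 + - x * (0 + - x * - (1 / 6))))) by ring.
    exact K.
Qed.

(** Multiplies the expansions of [exp (Re w)] and [cos (Im w) + i sin (Im w)]; the product agrees
    with that of [1 + w + w^2/2 + w^3/6]. *)
Lemma jet_cexp (w : R -> C) (c1 c2 c3 : C) : jet w 0 c1 c2 c3 ->
  jet (fun t => cexp (w t)) 1 c1 (c2 + c1 * c1 / 2) (c3 + c1 * c2 + c1 * c1 * c1 / 6).
Proof.
  intros H. pose proof (jet_fst _ _ _ _ _ H) as Hu. pose proof (jet_snd _ _ _ _ _ H) as Hv.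
  change (fst (RtoC 0)) with 0 in Hu. change (snd (RtoC 0)) with 0 in Hv.
  pose proof (jet_real_comp exp _ _ _ _ _ 2 (1 / 2) _ _ _ ltac:(lra) ltac:(lra)
    exp_cubic_bound Hu) as HE.
  pose proof (jet_real_comp cos _ _ _ _ _ 1 (1 / 2) _ _ _ ltac:(lra) ltac:(lra)
    cos_cubic_bound Hv) as HC.
  pose proof (jet_real_comp sin _ _ _ _ _ 1 (1 / 2) _ _ _ ltac:(lra) ltac:(lra)
    sin_cubic_bound Hv) as HS.
  pose proof (jet_mult _ _ _ _ _ _ _ _ _ _ HE (jet_plus _ _ _ _ _ _ _ _ _ _ HC
    (jet_mult _ _ _ _ _ _ _ _ _ _ (jet_const Ci) HS))) as HP.
  cbv beta in HP. clear HE HC HS Hu Hv H.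
  match type of HP with jet _ ?x0 ?x1 ?x2 ?x3 =>
    replace x0 with (RtoC 1) in HP;
    [ replace x1 with c1 in HP;
    [ replace x2 with (c2 + c1 * c1 / 2)%C in HP;
    [ replace x3 with (c3 + c1 * c2 + c1 * c1 * c1 / 6)%C in HP |] |] |]
  end.
  - eapply jet_ext; [exact Rlt_0_1 | | exact HP].
    intros t _. apply injective_projections; simpl; ring.
  - apply injective_projections; simpl; field.
  - apply injective_projections; simpl; field.
  - apply injective_projections; simpl; field.
  - apply injective_projections; simpl; field.
Qed.

(** * The coefficients of a starlike function *)

Lemma series_bigO (F : R -> C) (a : nat -> C) (n : nat) :
  (forall t, 0 < t < 1 ->
    @is_series C_AbsRing C_NormedModule (fun k => a k * RtoC t ^ k)%C (F t)) ->
  bigO (S n) (fun t => F t - partial_poly a n (RtoC t))%C.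
Proof.
  intros H.
  destruct (partial_poly_tail a (1 / 2) (F (1 / 2)) ltac:(lra) (H (1 / 2) ltac:(lra)))
    as [M [HM0 HM]].
  (* The comparison radius is 1/2, so the ratio is [2 t < 1/2]: the factor [1 / (1 - 2 t)] is at
     most 2, and [(2 t) ^ S n] supplies [2 ^ S n]. *)
  exists (2 * M * 2 ^ S n), (1 / 4). repeat split; [| lra |].
  { apply Rmult_le_pos; [lra | apply pow_le; lra]. }
  intros t Ht.
  assert (Hm : Cmod (RtoC t) = t) by (rewrite Cmod_R, Rabs_pos_eq; lra).
  specialize (HM (RtoC t) (F t) n ltac:(lra) (H t ltac:(lra))). rewrite Hm in HM.
  eapply Rle_trans; [exact HM |].
  replace (t / (1 / 2)) with (2 * t) by field. rewrite Rpow_mult_distr, Rmult_assoc, <- Rmult_assoc.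
  rewrite <- (Rmult_assoc (2 * M)).
  apply Rmult_le_compat_r; [apply pow_le; lra |].
  apply Rmult_le_compat_r; [apply pow_le; lra |].
  apply Rle_div_l; nra.
Qed.

Lemma partial_poly_5 (a : nat -> C) (z : C) :
  partial_poly a 5 z = (a 0%nat + z * (a 1%nat + z * (a 2%nat + z * (a 3%nat + z *
    (a 4%nat + z * a 5%nat)))))%C.
Proof.
  unfold partial_poly. rewrite !sum_n_Sn_C, sum_O.
  rewrite !Cpow_S. change (z ^ 0)%C with (RtoC 1). Cring.
Qed.

(** * Term-by-term differentiation along the real axis *)

Lemma is_derive_C_components (f : C -> C) (t : R) (d : C) :
  @is_derive C_AbsRing C_NormedModule f (RtoC t) d ->
  is_derive (fun x => fst (f (RtoC x))) t (fst d) /\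
  is_derive (fun x => snd (f (RtoC x))) t (snd d).
Proof.
  intros [_ H].
  specialize (H (RtoC t) (fun P HP => HP)).
  (* Restricts the complex differentiability estimate to real increments; its real and imaginary
     parts are then bounded by the modulus. *)
  assert (K : forall eps : posreal, locally t (fun y : R =>
    Cmod (f (RtoC y) - f (RtoC t) - RtoC (y - t) * d)%C <= eps * Rabs (y - t))).
  { intros eps. destruct (H eps) as [e He]. exists e. intros y Hy.
    specialize (He (RtoC y)).
    lapply He; clear He; [intros He |].
    2:{ change (Cmod (RtoC y - RtoC t)%C < e). rewrite <- RtoC_minus, Cmod_R. exact Hy. }
    change (Cmod (f (RtoC y) - f (RtoC t) - (RtoC y - RtoC t) * d)%C
      <= eps * Cmod (RtoC y - RtoC t)%C) in He.
    rewrite <- RtoC_minus, Cmod_R in He. exact He. }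
  split; (split; [apply is_linear_scal_l |]); intros x Hx;
    rewrite <- (@is_filter_lim_locally_unique R_AbsRing R_NormedModule t x Hx); intros eps;
    generalize (K eps); apply filter_imp; intros y Hy;
    eapply Rle_trans; try exact Hy.
  - eapply Rle_trans; [| apply re_le_Cmod]. right.
    change (Rabs (fst (f (RtoC y)) - fst (f (RtoC t)) - (y - t) * fst d)
      = Rabs (fst (f (RtoC y) - f (RtoC t) - RtoC (y - t) * d)%C)).
    f_equal. simpl. ring.
  - eapply Rle_trans; [| eapply Rle_trans; [apply Rmax_r | apply Rmax_Cmod]]. right.
    change (Rabs (snd (f (RtoC y)) - snd (f (RtoC t)) - (y - t) * snd d)
      = Rabs (snd (f (RtoC y) - f (RtoC t) - RtoC (y - t) * d)%C)).
    f_equal. simpl. ring.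
Qed.

Lemma CV_radius_ge_1 (a : nat -> R) :
  (forall t, 0 < t < 1 -> ex_pseries a t) ->
  forall x, Rabs x < 1 -> Rbar_lt (Rabs x) (CV_radius a).
Proof.
  intros H x Hx. pose proof (Rabs_pos x).
  (* The series converges at this point between [|x|] and 1, so its terms there are bounded and the
     radius of convergence is at least [s]. *)
  set (s := (1 + Rabs x) / 2).
  apply Rbar_lt_le_trans with s; [simpl; unfold s; lra |].
  apply CV_radius_bounded.
  destruct (H s ltac:(unfold s; lra)) as [l Hl].
  apply is_pseries_R in Hl. exact (is_series_bounded _ _ Hl).
Qed.

Lemma is_derive_real_pseries (g : R -> R) (a : nat -> R) (t d : R) :
  (forall x, 0 < x < 1 -> is_pseries a x (g x)) -> 0 < t < 1 ->
  is_derive g t d -> is_series (fun k => PS_derive a k * t ^ k) d.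
Proof.
  intros H Ht Hd.
  assert (Hr : Rbar_lt (Rabs t) (CV_radius a)).
  { apply CV_radius_ge_1; [intros x Hx; now exists (g x); apply H |].
    rewrite Rabs_pos_eq; lra. }
  assert (E : d = PSeries (PS_derive a) t).
  { rewrite <- (is_derive_unique _ _ _ Hd), <- (Derive_PSeries _ _ Hr).
    apply Derive_ext_loc.
    (* [g] is known to equal its series only on (0, 1); this radius keeps the neighbourhood of [t]
       inside. *)
    exists (mkposreal (Rmin t (1 - t)) ltac:(apply Rmin_glb_lt; lra)).
    intros y Hy. change (Rabs (y - t) < Rmin t (1 - t)) in Hy.
    pose proof (Rmin_l t (1 - t)). pose proof (Rmin_r t (1 - t)).
    apply Rabs_lt_between in Hy.
    symmetry. apply is_pseries_unique, H. lra. }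
  rewrite E. apply is_pseries_R, PSeries_correct.
  apply ex_pseries_derive, Hr.
Qed.

Lemma analytic_derivative_series (f : C -> C) (b : nat -> C) (t : R) (d : C) :
  analytic_disk_coef f b -> 0 < t < 1 ->
  @is_derive C_AbsRing C_NormedModule f (RtoC t) d ->
  @is_series C_AbsRing C_NormedModule
    (fun k => (RtoC (INR (S k)) * b (S k)) * RtoC t ^ k)%C d.
Proof.
  intros Hf Ht Hd.
  assert (Hs : forall x, 0 < x < 1 -> @is_series C_AbsRing C_NormedModule
    (fun k => b k * RtoC x ^ k)%C (f (RtoC x))).
  { intros x Hx. apply Hf. unfold in_disk. rewrite Cmod_R, Rabs_pos_eq; lra. }
  destruct (is_derive_C_components _ _ _ Hd) as [H1 H2].
  apply is_series_pair.
  - eapply is_series_ext; [| refine (is_derive_real_pseries _ (fun k => fst (b k)) t _ _ Ht H1)].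
    + intros k. rewrite <- RtoC_pow. unfold PS_derive. simpl fst.
      change (INR (S k) * fst (b (S k)) * t ^ k =
        (INR (S k) * fst (b (S k)) - 0 * snd (b (S k))) * t ^ k
        - (INR (S k) * snd (b (S k)) + 0 * fst (b (S k))) * 0). ring.
    + intros x Hx. apply is_pseries_R. eapply is_series_ext;
        [| exact (is_series_fst _ _ (Hs x Hx))].
      intros k. cbv beta. rewrite <- RtoC_pow. simpl. ring.
  - eapply is_series_ext; [| refine (is_derive_real_pseries _ (fun k => snd (b k)) t _ _ Ht H2)].
    + intros k. rewrite <- RtoC_pow. unfold PS_derive.
      change (INR (S k) * snd (b (S k)) * t ^ k =
        (INR (S k) * fst (b (S k)) - 0 * snd (b (S k))) * 0
        + (INR (S k) * snd (b (S k)) + 0 * fst (b (S k))) * t ^ k). ring.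
    + intros x Hx. apply is_pseries_R. eapply is_series_ext;
        [| exact (is_series_snd _ _ (Hs x Hx))].
      intros k. cbv beta. rewrite <- RtoC_pow. simpl. ring.
Qed.

(** * Comparison of coefficients *)

Lemma bigO_RtoC_5 :
  bigO 5 (fun t => RtoC t * (RtoC t * (RtoC t * (RtoC t * RtoC t))))%C.
Proof. repeat apply (bigO_mult 1 _ RtoC); apply bigO_RtoC. Qed.

Lemma jet_of_quartic (F : R -> C) (a0 a1 a2 a3 a4 : C) :
  bigO 5 (fun t => F t - (a0 + RtoC t * (a1 + RtoC t * (a2 + RtoC t * (a3
    + RtoC t * a4)))))%C -> jet F a0 a1 a2 a3.
Proof.
  intros H.
  assert (H4 : bigO 4 (fun t => (RtoC t * (RtoC t * (RtoC t * RtoC t))) * a4)%C).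
  { apply (bigO_mult 4 0); [| apply bigO_const].
    repeat apply (bigO_mult 1 _ RtoC); apply bigO_RtoC. }
  refine (bigO_ext 4 _ _ 1 Rlt_0_1 _
    (bigO_plus 4 _ _ (bigO_le 5 4 _ (le_S _ _ (le_n 4)) H) H4)).
  intros t _. cbv beta. ring.
Qed.

Lemma starlike_wp_coefs (f w : C -> C) (b c : nat -> C) :
  class_A f b -> analytic_disk_coef w c -> w 0 = 0 ->
  (forall z : C, in_disk z -> z <> 0 -> f z <> 0 /\
     exists d : C, @is_derive C_AbsRing C_NormedModule f z d /\
       Cdiv (Cmult z d) (f z) = wp (w z)) ->
  (b 2%nat = c 1%nat /\
   2 * b 3%nat = c 2%nat + 2 * c 1%nat * c 1%nat /\
   3 * b 4%nat = c 3%nat + 7 / 2 * c 1%nat * c 2%nat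
     + 5 / 2 * c 1%nat * c 1%nat * c 1%nat /\
   4 * b 5%nat = c 4%nat + 10 / 3 * c 1%nat * c 3%nat + 3 / 2 * c 2%nat * c 2%nat
     + 37 / 6 * c 1%nat * c 1%nat * c 2%nat
     + 5 / 2 * c 1%nat * c 1%nat * c 1%nat * c 1%nat)%C.
Proof.
  intros [Hf [Hb0 Hb1]] Hw Hw0 H.
  assert (Hdisk : forall t, 0 < t < 1 -> in_disk (RtoC t)).
  { intros t Ht. unfold in_disk. rewrite Cmod_R, Rabs_pos_eq; lra. }
  assert (Hne : forall t : R, 0 < t < 1 -> RtoC t <> RtoC 0).
  { intros t Ht E. apply RtoC_inj in E. lra. }
  assert (Hc0 : c 0%nat = RtoC 0).
  (* At [z = 0] the tail bound has ratio 0, so [w 0] equals the constant coefficient. *)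
  { assert (B : bigO 1 (fun t => w 0 - c 0%nat)%C).
    { apply (bigO_ext 1 (fun t => w 0 - partial_poly c 0 (RtoC 0))%C _ 1); [lra | |].
      - intros t _. unfold partial_poly. rewrite sum_O. simpl. f_equal. f_equal.
        apply Cmult_1_r.
      - destruct (partial_poly_tail c (1 / 2) (w (RtoC (1 / 2))) ltac:(lra)
          (Hw _ (Hdisk (1 / 2) ltac:(lra)))) as [M [HM0 HM]].
        exists 0, 1. repeat split; [lra | lra |]. intros t _.
        specialize (HM (RtoC 0) (w 0) 0%nat). rewrite Cmod_0 in HM.
        eapply Rle_trans; [apply HM |].
        + lra.
        + apply Hw. unfold in_disk. rewrite Cmod_0. lra.
        + right. simpl. field. }
    apply bigO_const_eq_0 in B. rewrite Hw0 in B.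
    replace (c 0%nat) with (- (RtoC 0 - c 0%nat))%C by ring. rewrite B. ring. }
  (* [D] is [f'], written with a formula that is meaningful at every [t] in (0, 1). *)
  set (D := fun t => (wp (w (RtoC t)) * f (RtoC t) / RtoC t)%C).
  assert (HD : forall t, 0 < t < 1 -> @is_series C_AbsRing C_NormedModule
    (fun k => (RtoC (INR (S k)) * b (S k)) * RtoC t ^ k)%C (D t)).
  { intros t Ht. destruct (H _ (Hdisk t Ht) (Hne t Ht)) as [Hfz [d [Hd E]]].
    replace (D t) with d; [now apply (analytic_derivative_series f) |].
    unfold D. rewrite <- E. field. split; [exact Hfz | now apply Hne]. }
  pose proof (series_bigO (fun t => f (RtoC t)) b 5 (fun t Ht => Hf _ (Hdisk t Ht))) as Jf.
  pose proof (series_bigO (fun t => w (RtoC t)) c 5 (fun t Ht => Hw _ (Hdisk t Ht))) as Jw.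
  pose proof (series_bigO D _ 5 HD) as JD.
  assert (JF : bigO 5 (fun t => f (RtoC t) / RtoC t - (1 + RtoC t * (b 2%nat + RtoC t *
    (b 3%nat + RtoC t * (b 4%nat + RtoC t * b 5%nat)))))%C).
  { apply bigO_div_RtoC. refine (bigO_ext 6 _ _ 1 Rlt_0_1 _ Jf).
    intros t Ht. rewrite partial_poly_5, Hb0, Hb1. field. now apply Hne. }
  assert (JW : jet (fun t => w (RtoC t) / RtoC t)%C (c 1%nat) (c 2%nat) (c 3%nat) (c 4%nat)).
  { apply jet_of_quartic with (c 5%nat).
    apply bigO_div_RtoC. refine (bigO_ext 6 _ _ 1 Rlt_0_1 _ Jw).
    intros t Ht. rewrite partial_poly_5, Hc0. field. now apply Hne. }
  assert (JE : jet (fun t => w (RtoC t)) 0 (c 1%nat) (c 2%nat) (c 3%nat)).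
  { apply jet_of_quartic with (c 4%nat).
    refine (bigO_ext 5 _ _ 1 Rlt_0_1 _ (bigO_plus 5 _ _ (bigO_le 6 5 _ (le_S _ _ (le_n 5)) Jw)
      (bigO_mult 5 0 _ _ bigO_RtoC_5 (bigO_const (c 5%nat))))).
    intros t Ht. cbv beta. rewrite partial_poly_5, Hc0. ring. }
  apply jet_cexp in JE.
  (* Dividing [z f' = f (1 + w e^w)] by [z^2] gives [(f' - f/z)/z = (f/z) (w/z) e^w]. On the left
     the coefficient of [z^k] in [f' - f/z] is [k b_(k+1)]. *)
  assert (JL : jet (fun t => (D t - f (RtoC t) / RtoC t) / RtoC t)%C (b 2%nat)
    (2 * b 3%nat) (3 * b 4%nat) (4 * b 5%nat)).
  { apply bigO_div_RtoC.
    (* The [t^5] term of [f'], with coefficient [6 b_6], is moved into the error. *)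
    refine (bigO_ext 5 _ _ 1 Rlt_0_1 _ (bigO_minus 5 _ _ (bigO_plus 5 _ _
      (bigO_le 6 5 _ (le_S _ _ (le_n 5)) JD)
      (bigO_mult 5 0 _ _ bigO_RtoC_5 (bigO_const (6 * b 6%nat)%C))) JF)).
    intros t Ht. cbv beta. rewrite partial_poly_5, Hb1.
    rewrite !S_INR, !RtoC_plus. change (INR 0) with 0. field. now apply Hne. }
  pose proof (jet_mult _ _ _ _ _ _ _ _ _ _ (jet_mult _ _ _ _ _ _ _ _ _ _
    (jet_of_quartic _ _ _ _ _ _ JF) JW) JE) as JR.
  assert (JL' : jet (fun t => f (RtoC t) / RtoC t * (w (RtoC t) / RtoC t) * cexp (w (RtoC t)))%C
    (b 2%nat) (2 * b 3%nat) (3 * b 4%nat) (4 * b 5%nat)).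
  { refine (jet_ext _ _ _ _ _ _ 1 Rlt_0_1 _ JL).
    intros t Ht. unfold D, wp. field. now apply Hne. }
  destruct (jet_unique _ _ _ _ _ _ _ _ _ JL' JR) as [E2 [E3 [E4 E5]]].
  clear - E2 E3 E4 E5.
  generalize dependent (b 5%nat). generalize dependent (b 4%nat).
  generalize dependent (b 3%nat). generalize dependent (b 2%nat).
  generalize (c 1%nat) (c 2%nat) (c 3%nat) (c 4%nat).
  intros c1 c2 c3 c4 b2 E2 b3 E3 b4 E4 b5 E5.
  (* The system is triangular: each relation involves only the earlier [b_k], which are eliminated
     in turn. *)
  assert (F2 : b2 = c1) by (rewrite E2; ring). clear E2. subst b2.
  assert (F3 : b3 = ((c2 + 2 * c1 * c1) / 2)%C).
  { replace b3 with (2 * b3 / 2)%C by field. rewrite E3. field. }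
  clear E3. subst b3.
  assert (F4 : b4 = ((c3 + 7 / 2 * c1 * c2 + 5 / 2 * c1 * c1 * c1) / 3)%C).
  { replace b4 with (3 * b4 / 3)%C by field. rewrite E4. field. }
  clear E4. subst b4.
  repeat split; [field | field |]. rewrite E5. field.
Qed.

(** Every monomial is bounded by a combination of squares. The total weights of
    [x1^2, x2^2, x3^2, x4^2] come to 21.25, 20.8125, 18 and 16, and the largest is the bound. *)
Lemma coef_form_bound (x1 x2 x3 x4 : R) :
  0 <= x1 -> 0 <= x2 -> 0 <= x3 -> 0 <= x4 ->
  x1 ^ 2 + x2 ^ 2 + x3 ^ 2 + x4 ^ 2 <= 1 ->
  4 * x1 ^ 6 + 5 * x1 ^ 4 * x2 + 25 * x1 ^ 2 * x2 ^ 2 + 9 * x2 ^ 3 + 16 * x1 ^ 3 * x3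
    + 4 * x1 * x2 * x3 + 16 * x3 ^ 2 + 18 * x2 * x4 <= 21.25.
Proof.
  intros H1 H2 H3 H4 H.
  assert (A : 0 <= x1 ^ 2) by apply pow2_ge_0.
  assert (B : 0 <= x2 ^ 2) by apply pow2_ge_0.
  assert (C3 : 0 <= x3 ^ 2) by apply pow2_ge_0.
  assert (D4 : 0 <= x4 ^ 2) by apply pow2_ge_0.
  assert (L1 : x1 <= 1) by nra.
  assert (L2 : x2 <= 1) by nra.
  assert (P12 : 0 <= x1 * x2 <= 1 / 2).
  { split; [now apply Rmult_le_pos |]. pose proof (pow2_ge_0 (x1 - x2)). lra. }
  assert (P13 : 0 <= x1 * x3 <= 1 / 2).
  { split; [now apply Rmult_le_pos |]. pose proof (pow2_ge_0 (x1 - x3)). lra. }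
  (* One factor [x1 * x2] is bounded by 1/2, the other by the mean of the squares. *)
  assert (Q12 : (x1 * x2) ^ 2 <= (x1 ^ 2 + x2 ^ 2) / 4).
  { apply Rle_trans with (1 / 2 * (x1 * x2)); [| pose proof (pow2_ge_0 (x1 - x2)); lra].
    simpl. rewrite Rmult_1_r. apply Rmult_le_compat_r; lra. }
  assert (T1 : x1 ^ 6 <= x1 ^ 2).
  { replace (x1 ^ 6) with (x1 ^ 2 * x1 ^ 4) by ring.
    assert (x1 ^ 4 <= 1) by (rewrite <- (pow1 4); apply pow_incr; lra). nra. }
  assert (T2 : x1 ^ 4 * x2 <= x1 ^ 2 * (1 / 2)).
  { replace (x1 ^ 4 * x2) with (x1 ^ 2 * (x1 * (x1 * x2))) by ring.
    apply Rmult_le_compat_l; [assumption |]. nra. }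
  assert (T3 : x1 ^ 3 * x3 <= x1 ^ 2 * (1 / 2)).
  { replace (x1 ^ 3 * x3) with (x1 ^ 2 * (x1 * x3)) by ring.
    apply Rmult_le_compat_l; lra. }
  assert (T4 : x2 ^ 3 <= x2 ^ 2).
  { replace (x2 ^ 3) with (x2 ^ 2 * x2) by ring. nra. }
  assert (T5 : 2 * (x1 * x2 * x3) <= x3 ^ 2 + (x1 * x2) ^ 2).
  { pose proof (pow2_ge_0 (x3 - x1 * x2)). nra. }
  (* The AM-GM weights keep the total coefficients of [x2 ^ 2] and [x4 ^ 2] below 21.25. *)
  assert (T6 : 18 * x2 * x4 <= 81 / 16 * x2 ^ 2 + 16 * x4 ^ 2).
  { pose proof (pow2_ge_0 (9 / 4 * x2 - 4 * x4)). nra. }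
  replace (x1 ^ 2 * x2 ^ 2) with ((x1 * x2) ^ 2) by ring.
  lra.
Qed.

Lemma Cmod_plus_le (x y : C) (p q : R) : Cmod x <= p -> Cmod y <= q -> Cmod (x + y)%C <= p + q.
Proof. intros Hx Hy. eapply Rle_trans; [apply Cmod_triangle | lra]. Qed.

Lemma Cmod_scal (r : R) (z : C) : Cmod (RtoC r * z)%C = Rabs r * Cmod z.
Proof. now rewrite Cmod_mult, Cmod_R. Qed.

Theorem mainTheorem19 (f : C -> C) (b : nat -> C) :
  class_A f b -> starlike_wp f -> Cmod (H3_1 b) <= 0.150627.
Proof.
  intros Hf [w [[[c Hw] [Hw0 Hd]] H]].
  pose proof (schwarz_coef_bessel w c Hw Hd) as HB.
  destruct (starlike_wp_coefs f w b c Hf Hw Hw0 H) as [E2 [E3 [E4 E5]]].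
  pose proof (coef_form_bound _ _ _ _ (Cmod_ge_0 (c 1%nat)) (Cmod_ge_0 (c 2%nat))
    (Cmod_ge_0 (c 3%nat)) (Cmod_ge_0 (c 4%nat)) HB) as HK.
  unfold H3_1. clear - E2 E3 E4 E5 HK.
  generalize dependent (b 5%nat). generalize dependent (b 4%nat).
  generalize dependent (b 3%nat). generalize dependent (b 2%nat).
  generalize dependent (c 4%nat). generalize dependent (c 3%nat).
  generalize dependent (c 2%nat). generalize dependent (c 1%nat).
  intros c1 c2 c3 c4 HK b2 E2 b3 E3 b4 E4 b5 E5.
  (* Nested to the right, with signs inside the real scalars, so that the triangle inequality splits
     off one monomial at a time. *)
  set (Q := (RtoC (-4) * (c1 ^ 6) + (RtoC 5 * (c1 ^ 4 * c2) + (RtoC (-25) * (c1 ^ 2 * c2 ^ 2)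
    + (RtoC 9 * c2 ^ 3 + (RtoC 16 * (c1 ^ 3 * c3) + (RtoC (-4) * (c1 * c2 * c3)
    + (RtoC (-16) * c3 ^ 2 + RtoC 18 * (c2 * c4))))))))%C).
  assert (EQ : (b3 * (b2 * b4 - b3 * b3) - b4 * (b4 - b2 * b3) + b5 * (b3 - b2 * b2))%C
    = (RtoC (/ 144) * Q)%C).
  { replace b3 with (2 * b3 / 2)%C by field. replace b4 with (3 * b4 / 3)%C by field.
    replace b5 with (4 * b5 / 4)%C by field. rewrite E2, E3, E4, E5.
    unfold Q. rewrite RtoC_inv by lra. field. }
  rewrite EQ, Cmod_scal.
  assert (HQ : Cmod Q <= 21.25).
  { eapply Rle_trans; [| exact HK]. unfold Q.
    eapply Rle_trans.
    - repeat (apply Cmod_plus_le; [apply Rle_refl |]). apply Rle_refl.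
    - rewrite !Cmod_scal, !Cmod_mult, !Cmod_pow.
      unfold Rabs; repeat (destruct Rcase_abs; [| lra] || destruct Rcase_abs; try lra). }
  rewrite Rabs_pos_eq by lra. lra.
Qed.
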